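(* Let $n,m\ge 1$ be integers and let $\kappa\in\mathbb C$, $\kappa\neq 0$. Consider the affine action $\Phi_\kappa$ of the super Weyl groupoid $\mathcal W_{n,m}$ on $V=\mathbb C^{n+m}$. Then: (1) all the orbits of $\mathcal W_{n,m}$ under $\Phi_\kappa$ are finite if and only if $\kappa$ is not negative special; (2) if $\kappa$ is not negative special, then the algebra of polynomial invariants $P[V]^{\Phi_\kappa}$ is finitely generated (as a $\mathbb C$-algebra); (3) if $\kappa$ is neither negative special nor positive special, then $P[V]^{\Phi_\kappa}$ separates the orbits of $\Phi_\kappa$.
   Context: Let $V=\mathbb C^{n+m}$ with coordinates $(u,v)=(u_1,\dots,u_n,v_1,\dots,v_m)$. The action $\Phi_\kappa$ of the super Weyl groupoid $\mathcal W_{n,m}$ (of the Lie superalgebra $\mathfrak{gl}(n,m)$) on $V$ is given by the following (partially defined) affine bijections: (i) the group $S_n\times S_m$ acts on $V$ by permuting $u_1,\dots,u_n$ and $v_1,\dots,v_m$ separately; (ii) for each $1\le i\le n$, $1\le p\le m$, the shift $(u,v)\mapsto(u_1,\dots,u_i+1,\dots,u_n,v_1,\dots,v_p-1,\dots,v_m)$, defined only on the hyperplane $u_i-\kappa v_p=-\tfrac12(1+\kappa)$ and mapping it onto the hyperplane $u_i-\kappa v_p=\tfrac12(1+\kappa)$; (iii) the inverses of the shifts in (ii), defined on the hyperplane $u_i-\kappa v_p=\tfrac12(1+\kappa)$. The orbit of $z\in V$ is the set of all points obtained from $z$ by applying successively finitely many of these maps, each one at a point where it is defined (i.e. the class of $z$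 for the equivalence relation generated by these maps). $P[V]^{\Phi_\kappa}$ is the algebra of polynomials $f\in\mathbb C[u_1,\dots,u_n,v_1,\dots,v_m]$ that are invariant under all these maps. Equivalently, $f$ is symmetric in $u_1,\dots,u_n$ and in $v_1,\dots,v_m$ separately, and for all $i,p$ it satisfies $f(u+\frac12\varepsilon_i,v-\frac12\delta_p)=f(u-\frac12\varepsilon_i,v+\frac12\delta_p)$ on the hyperplane $u_i-\kappa v_p=0$, where $\varepsilon_i$, $\delta_p$ are the standard basis vectors. An algebra of invariants separates the orbits if for any two distinct orbits there is an element of the algebra taking different values on them. $\kappa$ is called negative special if $\kappa=-\frac pq$, and positive special if $\kappa=\frac pq$, for some integers $1\le p\le m$, $1\le q\le n$. *)

(* Defs.v *)
From Stdlib Require Import Relation_Operators.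
From mathcomp Require Import all_boot all_order all_fingroup all_algebra.
From mathcomp Require Import classical_sets cardinality reals.
From mathcomp Require Import complex mpoly.

Set Implicit Arguments.
Unset Strict Implicit.
Unset Printing Implicit Defensive.

Import GRing.Theory.
Local Open Scope ring_scope.

Section SuperWeylGroupoid.
Variables (K : fieldType) (n m : nat).

(* A point (u, v) of V = K^(n+m) is a row vector of length n + m. *)
Local Notation V := 'rV[K]_(n + m).

Definition ucoord (z : V) (i : 'I_n) : K := z 0 (lshift m i).
Definition vcoord (z : V) (p : 'I_m) : K := z 0 (rshift n p).

Definition perm_act (s : 'S_n) (t : 'S_m) (z : V) : V :=
  row_mx (col_perm s (lsubmx z)) (col_perm t (rsubmx z)).

Definition shift_vec (i : 'I_n) (p : 'I_m) : V :=
  delta_mx 0 (lshift m i) - delta_mx 0 (rshift n p).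

(* [groupoid_step kappa z w] : one of the partial maps of the action is
   defined at z and sends z to w.  Every such map has its inverse on the list,
   so the reflexive transitive closure below is an equivalence relation. *)
Inductive groupoid_step (kappa : K) : V -> V -> Prop :=
| StepPerm (s : 'S_n) (t : 'S_m) (z : V) :
    groupoid_step kappa z (perm_act s t z)
| StepShift (i : 'I_n) (p : 'I_m) (z : V) :
    ucoord z i - kappa * vcoord z p = - ((1 + kappa) / 2%:R) ->
    groupoid_step kappa z (z + shift_vec i p)
| StepUnshift (i : 'I_n) (p : 'I_m) (z : V) :
    ucoord z i - kappa * vcoord z p = (1 + kappa) / 2%:R ->
    groupoid_step kappa z (z - shift_vec i p).

Definition groupoid_orbit (kappa : K) (z : V) : set V :=
  [set w | clos_refl_trans V (groupoid_step kappa) z w]%classic.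

Definition eval_at (f : {mpoly K[n + m]}) (z : V) : K :=
  f.@[fun k => z 0 k].

Definition invariants (kappa : K) : set {mpoly K[n + m]} :=
  [set f | forall z w, groupoid_step kappa z w ->
             eval_at f w = eval_at f z]%classic.

Definition separates_orbits (kappa : K) (A : set {mpoly K[n + m]}) : Prop :=
  forall z w : V, groupoid_orbit kappa z <> groupoid_orbit kappa w ->
    exists2 f, A f & eval_at f z <> eval_at f w.

End SuperWeylGroupoid.

Arguments invariants {K} n m kappa _.

(* A is the K-subalgebra K[g_1, ..., g_k] for some g_1, ..., g_k. *)
Definition finitely_generated (K : fieldType) (N : nat)
    (A : set {mpoly K[N]}) : Prop :=
  exists (k : nat) (g : k.-tuple {mpoly K[N]}),
    A = range (fun P : {mpoly K[k]} => P \mPo g).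

Definition negative_special (K : fieldType) (n m : nat) (kappa : K) : Prop :=
  exists p q : nat,
    [/\ (1 <= p <= m)%N, (1 <= q <= n)%N & kappa = - (p%:R / q%:R)].

Definition positive_special (K : fieldType) (n m : nat) (kappa : K) : Prop :=
  exists p q : nat,
    [/\ (1 <= p <= m)%N, (1 <= q <= n)%N & kappa = p%:R / q%:R].

(* Main.v *)
(* Regard u_i as an edge of length kappa centred at u_i, and v_p as an edge of
   length 1 centred at kappa v_p.  A shift replaces a path made of a kappa-edge
   followed by a 1-edge by the path with the same ends whose steps are exchanged,
   so the boundary (heads minus tails) is constant on orbits, and its power sums
   b_r are invariant polynomials.

   The leading form of b_(r+1) is, up to a constant, the deformed power sum
   sum_j c_j x_j^r with weights c_j in {kappa, 1}.  When kappa is not negative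
   special no nonempty sum of weights vanishes, so every ideal containing these
   power sums contains a power of each variable; hence C[u, v] is a finite module
   over C[b_2, b_3, ...].  This gives finiteness of the orbits (level sets of the b_r
   are finite) and, by Hilbert's basis theorem, finite generation.  When
   kappa = - p / q, a staircase of q kappa-edges and p 1-edges can be shifted forever.

   For separation, shift until no kappa-edge is followed by a 1-edge.  Two such
   terminal configurations with the same b_r have the same boundary, and after
   cancelling their common edges a flow argument leaves a kappa-edges in one and
   b 1-edges in the other with kappa a = b, so that a = b = 0 unless kappa is
   positive special. *)
Require Import Defs.
From Stdlib Require Import Relation_Operators.
From mathcomp Require Import all_boot all_order all_fingroup all_algebra.
From mathcomp Require Import boolp classical_sets cardinality reals.
From mathcomp Require Import complex mpoly ring.

Set Implicit Arguments.
Unset Strict Implicit.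
Unset Printing Implicit Defensive.

Import Order.TTheory GRing.Theory Num.Theory.
Local Open Scope ring_scope.
Local Open Scope classical_set_scope.

(** * Finitely generated modules and Hilbert's basis theorem *)

Lemma subrACA (V : zmodType) (x y z t : V) : x - y - (z - t) = x - z - (y - t).
Proof. by rewrite !opprD !opprK addrACA. Qed.

Section Modules.
Variable R : comNzRingType.
Implicit Types (D L M N : set R) (s : seq R).

(** [D] is a mere set of multipliers, not a ring, so that enlarging the base ring amounts to
    inserting one more element in [D]. *)
Definition submod D N :=
  [/\ N 0, forall x y, N x -> N y -> N (x - y) & forall a x, D a -> N x -> N (a * x)].

Lemma submodD D N x y : submod D N -> N x -> N y -> N (x + y).
Proof.
by case=> N0 NB _ Nx Ny; rewrite -[y]opprK -[- y]sub0r; apply/NB/NB.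
Qed.

Lemma submod_sum D N (I : Type) (r : seq I) (P : pred I) (F : I -> R) :
  submod D N -> (forall i, P i -> N (F i)) -> N (\sum_(i <- r | P i) F i).
Proof.
move=> smN NF; apply: (big_ind N) => // [|x y]; first by case: smN.
exact: submodD smN.
Qed.

Lemma submodI D L N : submod D L -> submod D N -> submod D (L `&` N).
Proof.
move=> [L0 LB LZ] [N0 NB NZ]; split=> // [x y [? ?] [? ?]|a x Da [? ?]].
  by split; [apply: LB | apply: NB].
by split; [apply: LZ | apply: NZ].
Qed.

(* [fg D L]: the module L over the ring generated by D is finitely generated.
   Quantifying over all submodules N avoids linear combinations. *)
Definition fg D L := exists2 s : seq R, [set` s] `<=` L &
  forall N, submod D N -> [set` s] `<=` N -> L `<=` N.

Definition noetherian D M := forall L, submod D L -> L `<=` M -> fg D L.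

Lemma lift_seq (P : R -> R -> Prop) s :
  (forall x, x \in s -> exists y, P x y) ->
  exists2 t : seq R, (forall y, y \in t -> exists x, P x y) &
    forall x, x \in s -> exists2 y, y \in t & P x y.
Proof.
elim: s => [|x s IHs] exP; first by exists [::].
have [y Pxy] := exP x (mem_head _ _).
have [t tP sP] := IHs (fun z zs => exP z (mem_behead (s := x :: s) zs)).
exists (y :: t) => z; rewrite inE => /predU1P[->|].
- by exists x.
- exact: tP.
- by exists y; rewrite ?mem_head.
- by case/sP=> y' y't Pzy'; exists y'; rewrite ?inE ?y't ?orbT.
Qed.

Definition sum_set L M : set R := [set x | exists2 y, L y & M (x - y)].

(** The [M1]-components of elements of [L] form a submodule of [M1]; lifts of its generators,
    together with generators of the part of [L] inside [M2], generate [L]. The sum need not be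
    direct, so an element may have several components. *)
Lemma noetherian_sum D M1 M2 : submod D M1 -> submod D M2 ->
  noetherian D M1 -> noetherian D M2 -> noetherian D (sum_set M1 M2).
Proof.
move=> sm1 sm2 no1 no2 L smL LM.
pose proj N : set R := [set a | M1 a /\ exists2 x, N x & M2 (x - a)].
have sm_proj N : submod D N -> submod D (proj N).
  case: sm1 sm2 => M10 M1B M1Z [M20 M2B M2Z] [N0 NB NZ].
  split=> [|a b [M1a [x Nx M2x]] [M1b [y Ny M2y]]|c a Dc [M1a [x Nx M2x]]].
  - by split=> //; exists 0; rewrite ?subr0.
  - split; first exact: M1B.
    exists (x - y); first exact: NB.
    by rewrite subrACA; apply: M2B.
  - split; first exact: M1Z.
    by exists (c * x); [apply: NZ | rewrite -mulrBr; apply: M2Z].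
have [|s1 s1L L1gen] := no1 _ (sm_proj _ smL); first by move=> a [].
have [|s2 s2L L2gen] := no2 _ (submodI smL sm2); first by move=> a [].
have [|t tP s1P] := @lift_seq (fun a x => L x /\ M2 (x - a)) s1.
  by move=> a /s1L[_ [x Lx M2x]]; exists x.
exists (t ++ s2) => [x|N smN sN x Lx] /=.
  by rewrite mem_cat => /orP[/tP[a []]|/s2L[]].
have [a M1a M2xa] := LM _ Lx.
have smLN := submodI smL smN.
(* Test generation on the projection of the intersection of [L] and [N]: it contains [s1] because
   the lifts [t] lie in [N]. *)
have [||_ [y [Ly Ny] M2ya]] := L1gen _ (sm_proj _ smLN) _ a.
- move=> b bs1; split; first by case: (s1L b bs1).
  have [y yt [Ly M2y]] := s1P b bs1; exists y => //; split=> //.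
  by apply: sN; rewrite /= mem_cat yt.
- by split=> //; exists x.
rewrite -[x](subrK y); apply: submodD (smN) _ Ny; apply: (L2gen N smN).
  by move=> b bs2; apply: sN; rewrite /= mem_cat bs2 orbT.
split; first by case: smL => _ LB _; apply: LB.
have -> : x - y = (x - a) - (y - a) by rewrite opprB addrA subrK.
by case: sm2 => _ M2B _; apply: M2B.
Qed.

(* [poly_lt M b d]: values at b of polynomials over M of degree < d. *)
Fixpoint poly_lt M (b : R) d : set R :=
  if d is d'.+1 then [set x | exists2 c, M c & poly_lt M b d' (x - c * b ^+ d')]
  else [set 0].

Definition adjoin M b : set R := [set x | exists d, poly_lt M b d x].

Lemma submod_poly_lt D M b d : submod D M -> submod D (poly_lt M b d).
Proof.
move=> [M0 MB MZ]; elim: d => [|d [V0 VB VZ]] /=.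
  split=> // [x y -> ->|a x _ ->]; first by rewrite subr0.
  by rewrite mulr0.
split=> [|x y [c Mc Vx] [e Me Vy]|a x Da [c Mc Vx]].
- by exists 0 => //; rewrite mul0r subr0.
- exists (c - e); first exact: MB.
  by rewrite mulrBl subrACA; apply: VB.
- exists (a * c); first exact: MZ.
  by rewrite -mulrA -mulrBr; apply: VZ.
Qed.

Lemma poly_ltS D M b d : submod D M -> poly_lt M b d `<=` poly_lt M b d.+1.
Proof. by case=> M0 _ _ x Vx; exists 0; rewrite // mul0r subr0. Qed.

Lemma poly_lt_leq D M b d e :
  submod D M -> (d <= e)%N -> poly_lt M b d `<=` poly_lt M b e.
Proof.
move=> smM /subnK <-; elim: (e - d)%N => // k IHk x /IHk.
exact: poly_ltS smM _.
Qed.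

Lemma poly_lt_mul D M b d x :
  submod D M -> poly_lt M b d x -> poly_lt M b d.+1 (b * x).
Proof.
move=> smM; elim: d x => [x /= ->|d IHd x [c Mc /IHd Vx]].
  by exists 0; [case: smM | rewrite mulr0 mul0r subr0].
exists c => //; move: Vx; rewrite mulrBr [c * _]mulrC mulrA -exprS mulrC.
by rewrite [_ * c]mulrC.
Qed.

Lemma submod_adjoin D M b : submod D M -> submod (b |` D) (adjoin M b).
Proof.
move=> smM; split=> [|x y [d Vx] [e Vy]|a x Da [d Vx]]; first by exists 0%N.
  exists (maxn d e); case: (submod_poly_lt b (maxn d e) smM) => _ VB _.
  by apply: VB; [apply: poly_lt_leq smM _ _ Vx|apply: poly_lt_leq smM _ _ Vy];
    rewrite ?leq_maxl ?leq_maxr.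
case: Da => [->|Da]; first by exists d.+1; apply: poly_lt_mul smM _.
by exists d; case: (submod_poly_lt b d smM) => _ _; apply.
Qed.

Lemma sub_adjoin D M b : submod D M -> M `<=` adjoin M b.
Proof.
by move=> smM x Mx; exists 1%N, x => //; rewrite expr0 mulr1 subrr.
Qed.

(* As in Hilbert's basis theorem, use the modules [lc L d] of leading coefficients
   of the elements of degree d of a submodule L. *)
Lemma noetherian_adjoin D M b :
  submod D M -> noetherian D M -> noetherian (b |` D) (adjoin M b).
Proof.
move=> smM noM L smL LM.
have smLD : submod D L by case: smL => L0 LB LZ; split=> // a x Da; apply: LZ; right.
pose lc N d : set R := [set c | M c /\ exists2 x, N x & poly_lt M b d (x - c * b ^+ d)].
have sm_lc N d : submod D N -> submod D (lc N d).
  case: (smM) (submod_poly_lt b d smM) => M0 MB MZ [V0 VB VZ] [N0 NB NZ].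
  split=> [|c e [Mc [x Nx Vx]] [Me [y Ny Vy]]|a c Da [Mc [x Nx Vx]]].
  - by split=> //; exists 0; rewrite // mul0r subr0.
  - split; first exact: MB.
    exists (x - y); first exact: NB.
    by rewrite mulrBl subrACA; apply: VB.
  - split; first exact: MZ.
    by exists (a * x); [apply: NZ | rewrite -mulrA -mulrBr; apply: VZ].
have lcS N d e : submod (b |` D) N -> (d <= e)%N -> lc N d `<=` lc N e.
  move=> [_ _ NZ] /subnK <-; elim: (e - d)%N => // k IHk c /IHk[Mc [x Nx Vx]].
  split=> //; exists (b * x); first by apply: NZ => //; left.
  have := poly_lt_mul smM Vx.
  by rewrite mulrBr [c * _]mulrC mulrA -exprS mulrC [_ * c]mulrC.
pose lcoo := [set c | exists d, lc L d c].
have sm_lcoo : submod D lcoo.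
  split=> [|c e [d lc_c] [d' lc_e]|a c Da [d lc_c]].
  - by exists 0%N; case: (sm_lc L 0%N smLD).
  - exists (maxn d d'); case: (sm_lc L (maxn d d') smLD) => _ lcB _.
    by apply: lcB; [apply: lcS lc_c|apply: lcS lc_e]; rewrite ?leq_maxl ?leq_maxr.
  - by exists d; case: (sm_lc L d smLD) => _ _; apply.
have [|soo sooL oogen] := noM _ sm_lcoo; first by move=> c [d []].
(* The modules [lc L d] increase with [d], so finitely many generators of their union already lie in
   one of them. *)
have [d0 sooL0] : exists d0, [set` soo] `<=` lc L d0.
  elim: (soo) sooL => [_|c s IHs sL]; first by exists 0%N.
  have [|d1 sL1] := IHs; first by move=> x xs; apply: sL; rewrite /= inE xs orbT.
  have [d2 cL2] := sL c (mem_head _ _).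
  exists (maxn d1 d2) => x; rewrite /= inE => /predU1P[->|xs].
    exact: lcS (leq_maxr _ _) _ cL2.
  exact: lcS (leq_maxl _ _) _ (sL1 _ xs).
have gens d s : [set` s] `<=` lc L d -> exists2 t : seq R, [set` t] `<=` L &
    forall N, submod (b |` D) N -> [set` t] `<=` N -> [set` s] `<=` lc (L `&` N) d.
  move=> sL.
  have [|t tP sP] :=
      @lift_seq (fun c x => [/\ M c, L x & poly_lt M b d (x - c * b ^+ d)]) s.
    by move=> c /sL[Mc [x Lx Vx]]; exists x.
  exists t => [x /tP[c []]//|N smN tN c /sP[x xt [Mc Lx Vx]]].
  by split=> //; exists x => //; split=> //; apply: tN.
have [too tooL tooP] := gens _ _ sooL0.
(* The finitely many degrees below [d0] are treated one at a time. *)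
have [tlt tltL tltP] : exists2 t : seq R, [set` t] `<=` L &
    forall N, submod (b |` D) N -> [set` t] `<=` N ->
      forall d, (d < d0)%N -> lc L d `<=` lc (L `&` N) d.
  elim: (d0) => [|d [t tL tP]]; first by exists [::].
  have [|s sL sP] := noM _ (sm_lc L d smLD); first by move=> c [].
  have [t' t'L t'P] := gens _ _ sL.
  exists (t ++ t') => [x|N smN tN e].
    by rewrite /= mem_cat => /orP[/tL|/t'L].
  rewrite ltnS leq_eqVlt => /predU1P[->|]; last first.
    by apply: tP => // x xt; apply: tN; rewrite /= mem_cat xt.
  apply: sP.
    apply: sm_lc; case: (submodI smL smN) => ? ? LZ; split=> // a x Da.
    by apply: LZ; right.
  by apply: t'P => // x xt; apply: tN; rewrite /= mem_cat xt orbT.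
exists (too ++ tlt) => [x|N smN tN x Lx].
  by rewrite /= mem_cat => /orP[/tooL|/tltL].
have smLN := submodI smL smN.
have lcLN d : lc L d `<=` lc (L `&` N) d.
  have [d0d|dd0] := leqP d0 d; last first.
    by apply: tltP => // y yt; apply: tN; rewrite /= mem_cat yt orbT.
  move=> c lc_c; apply: (oogen (lc (L `&` N) d)); last by exists d.
    by apply: sm_lc; case: smLN => ? ? LZ; split=> // a y Da; apply: LZ; right.
  move=> e es; apply: lcS smLN d0d _ _; apply: tooP => // y yt.
  by apply: tN; rewrite /= mem_cat yt.
(* Descend on the degree of [x] by subtracting a common element of [L] and [N] with the same leading
   coefficient. *)
have [d Vx] := LM _ Lx; elim: d x Vx Lx => [x /= -> _|d IHd x [c Mc Vx] Lx].
  by case: smN.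
have [|_ [y [Ly Ny] Vy]] := lcLN d c; first by split=> //; exists x.
rewrite -[x](subrK y); apply: submodD (smN) _ Ny; apply: IHd; last first.
  by case: smL => _ LB _; apply: LB.
have -> : x - y = (x - c * b ^+ d) - (y - c * b ^+ d) by rewrite opprB addrA subrK.
by case: (submod_poly_lt b d smM) => _ VB _; apply: VB.
Qed.

End Modules.

(** * Nilpotency modulo weighted power sums *)

Section PowerSums.
Variable R : comNzRingType.
Implicit Types I : set R.

Definition ideal I := submod setT I.

Definition ideal_adjoin I b : set R := [set x | exists y, I (x - y * b)].

Definition nilpotent_mod I a := exists M, I (a ^+ M).

Lemma idealMl I a x : ideal I -> I x -> I (a * x).
Proof. by case=> _ _; apply. Qed.

Lemma idealMr I a x : ideal I -> I x -> I (x * a).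
Proof. by rewrite mulrC; apply: idealMl. Qed.

Lemma ideal_adjoinP I b : ideal I -> ideal (ideal_adjoin I b).
Proof.
move=> idI; have [I0 IB IZ] := idI; split=> [|x y [z Iz] [t It]|a x _ [z Iz]].
- by exists 0; rewrite mul0r subr0.
- by exists (z - t); rewrite mulrBl subrACA; apply: IB.
- by exists (a * z); rewrite -mulrA -mulrBr; apply: idealMl.
Qed.

Lemma sub_ideal_adjoin I b : I `<=` ideal_adjoin I b.
Proof. by move=> x Ix; exists 0; rewrite mul0r subr0. Qed.

Lemma nilpotent_mod_adjoinM I a b c : ideal I ->
  nilpotent_mod (ideal_adjoin I b) a -> nilpotent_mod (ideal_adjoin I c) a ->
  nilpotent_mod (ideal_adjoin I (b * c)) a.
Proof.
move=> idI [M [y Iy]] [N [z Iz]]; exists (M + N)%N, (y * z).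
have -> : a ^+ (M + N) - y * z * (b * c) =
    (a ^+ M - y * b) * a ^+ N + (y * b) * (a ^+ N - z * c) by rewrite exprD; ring.
by apply: (submodD idI); [apply: idealMr | apply: idealMl].
Qed.

(** Geometrically, the zeros of [I] are covered by the zeros of the factors, so nilpotency may be
    checked on each piece. *)
Lemma nilpotent_mod_prod I a (s : seq R) : ideal I -> I (\prod_(b <- s) b) ->
  (forall b, b \in s -> nilpotent_mod (ideal_adjoin I b) a) -> nilpotent_mod I a.
Proof.
move=> idI Is nil_s.
suff [M [y Iy]] : nilpotent_mod (ideal_adjoin I (\prod_(b <- s) b)) a.
  by exists M; rewrite -[a ^+ M](subrK (y * \prod_(b <- s) b));
    apply: (submodD idI Iy); apply: idealMl.
elim: s nil_s {Is} => [_|b s IHs nil_s].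
  by exists 0%N, 1; rewrite big_nil mulr1 subrr; case: idI.
rewrite big_cons; apply: nilpotent_mod_adjoinM => //.
  by apply: nil_s; rewrite mem_head.
by apply: IHs => c cs; apply: nil_s; rewrite inE cs orbT.
Qed.

Lemma ideal_weighted_horner I (J : finType) (T : {set J}) (c x : J -> R) k
    (h : {poly R}) : ideal I ->
  (forall r, (0 < r <= k)%N -> I (\sum_(j in T) c j * x j ^+ r)) ->
  (size h <= k.+1)%N -> h`_0 = 0 -> I (\sum_(j in T) c j * h.[x j]).
Proof.
move=> idI Ip size_h h0.
have -> : \sum_(j in T) c j * h.[x j] =
    \sum_(r < k.+1) h`_r * \sum_(j in T) c j * x j ^+ r.
  under [RHS]eq_bigr do rewrite mulr_sumr.
  rewrite exchange_big; apply: eq_bigr => j _.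
  by rewrite (horner_coef_wide _ size_h) mulr_sumr; apply: eq_bigr => r _; rewrite mulrCA.
apply: (submod_sum (D := setT)) => // -[[|r] rk] _ /=; first by rewrite h0 mul0r; case: idI.
by apply: idealMl => //; apply: Ip.
Qed.

(* With h = t * prod_(k != j) (t - x_k), the sum of the c_l h(x_l) reduces to
   c_j h(x_j), so x_j * prod_(k != j) (x_j - x_k) belongs to I; modulo
   x_j - x_k the indices j and k merge into one of weight c_j + c_k. *)
Lemma nilpotent_mod_power_sums (J : finType) (x : J -> R) k (T : {set J})
    (c : J -> R) I : ideal I -> (#|T| <= k)%N ->
  (forall S : {set J}, S \subset T -> S != finset.set0 ->
     exists e, e * \sum_(j in S) c j = 1) ->
  (forall r, (0 < r <= k)%N -> I (\sum_(j in T) c j * x j ^+ r)) ->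
  forall j, j \in T -> nilpotent_mod I (x j).
Proof.
elim: k T c I => [|k IHk] T c I idI cardT unit_c Ip j jT.
  by move: cardT; rewrite leqn0 cards_eq0 => /eqP T0; rewrite T0 inE in jT.
have cardTj : (#|T :\ j| <= k)%N by rewrite (cardsD1 j) jT in cardT.
pose h : {poly R} := 'X * \prod_(l <- enum (T :\ j)) ('X - (x l)%:P).
have hx y : h.[y] = y * \prod_(l <- enum (T :\ j)) (y - x l).
  rewrite hornerM hornerX horner_prod; congr (_ * _).
  by apply: eq_bigr => l _; rewrite hornerXsubC.
have size_h : (size h <= k.+2)%N.
  rewrite /h size_monicM ?monicX ?monic_neq0 ?monic_prod_XsubC //.
  by rewrite size_polyX size_prod_XsubC addnS /= -cardE !ltnS.
have h0 : h`_0 = 0 by rewrite coefXM.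
have := ideal_weighted_horner idI Ip size_h h0.
rewrite (big_setD1 j) //= [X in _ + X]big1 ?addr0; last first.
  move=> l lTj; rewrite hx (big_rem l) ?mem_enum //= subrr.
  by rewrite mul0r mulr0 mulr0.
have [e] : exists e, e * \sum_(i in [set j]%SET) c i = 1.
  by apply: unit_c; rewrite ?finset.sub1set -?card_gt0 ?cards1.
rewrite big_set1 => ec1 Ich.
apply: (@nilpotent_mod_prod _ _ (x j :: [seq x j - x l | l <- enum (T :\ j)])) => //.
  rewrite big_cons big_map -hx -[h.[_]]mul1r -ec1 -mulrA.
  exact: idealMl.
move=> b; rewrite inE => /predU1P[->|/mapP[l]].
  by exists 1%N, 1; rewrite expr1 mul1r subrr; case: idI.
rewrite mem_enum => lTj ->{b}; set I' := ideal_adjoin _ _.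
have idI' : ideal I' by apply: ideal_adjoinP.
have I'X r : I' (x j ^+ r - x l ^+ r).
  rewrite subrXX; apply: idealMr => //.
  by exists 1; rewrite mul1r subrr; case: idI.
have lT : l \in T by case/setD1P: lTj.
have lj : l != j by case/setD1P: lTj.
(* The index [j] is dropped and its weight goes to [l]: a sum of new weights over a set containing
   [l] is the sum of old weights over that set with [j] added. *)
pose c' i := if i == l then c j + c l else c i.
have [||M I'M] := IHk (T :\ j) c' I' idI' cardTj _ _ l lTj.
- move=> S ST S0; have [lS|lS] := boolP (l \in S); last first.
    have [||e' e'1] := unit_c S => //; first by rewrite (fintype.subset_trans ST) ?finset.subD1set.
    exists e'; rewrite -e'1; congr (_ * _); apply: eq_bigr => i iS.
    by rewrite /c'; case: eqP => // il; rewrite -il iS in lS.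
  have jS : j \notin S by apply/negP => /(fintype.subsetP ST); rewrite !inE eqxx.
  have [||e' e'1] := unit_c (j |: S)%SET.
  + by rewrite finset.subUset finset.sub1set jT (fintype.subset_trans ST) ?finset.subD1set.
  + by rewrite -card_gt0 cardsU1 jS.
  exists e'; rewrite -e'1 big_setU1 //= (big_setD1 l) //= [in RHS](big_setD1 l) //=.
  rewrite /c' eqxx addrA; congr (_ * (_ + _)); apply: eq_bigr => i.
  by rewrite !inE => /andP[/negPf->].
- move=> r /andP[r0 rk].
  have /(@sub_ideal_adjoin _ (x j - x l)) I'p := Ip r (introT andP (conj r0 (leqW rk))).
  have -> : \sum_(i in T :\ j) c' i * x i ^+ r =
      \sum_(i in T) c i * x i ^+ r - c j * (x j ^+ r - x l ^+ r).
    rewrite (big_setD1 j jT) /= (big_setD1 l lTj) /= [in RHS](big_setD1 l lTj) /=.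
    rewrite [X in _ + X](_ : _ = \sum_(i in (T :\ j) :\ l) c i * x i ^+ r).
      by rewrite /c' eqxx; ring.
    by apply: eq_bigr => i; rewrite !inE /c' => /andP[/negPf->].
  by case: (idI') => _ I'B _; apply: I'B => //; apply: idealMl.
exists M; rewrite -[x j ^+ M](subrK (x l ^+ M)).
exact: (submodD idI').
Qed.

End PowerSums.

(** * Subalgebras of polynomial rings *)

Section MpolyFiniteness.
Variables (K : fieldType) (n : nat).
Local Notation P := {mpoly K[n]}.

Definition scalars : set P := range (@mpolyC n K).

Definition multipliers (t : seq P) : set P := scalars `|` [set` t].

(** [M] is built as a sum of lines, and a subspace of a line is zero or the whole line. *)
Lemma noetherian_span (s : seq P) : exists M : set P,
  [/\ submod scalars M, noetherian scalars M & [set` s] `<=` M].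
Proof.
elim: s => [|g s [M [smM noM sM]]].
  exists [set 0]; split.
  - by split=> // [x y -> ->|a x _ ->]; rewrite ?subr0 ?mulr0.
  - by move=> L smL L0; exists [::] => // N [N0 _ _] _ x /L0 ->.
  - by move=> x.
pose line : set P := [set x | exists c, x = c *: g].
have sm_line : submod scalars line.
  split=> [|_ _ [a ->] [b ->]|_ _ [a _ <-] [b ->]].
  - by exists 0; rewrite scale0r.
  - by exists (a - b); rewrite scalerBl.
  - by exists (a * b); rewrite mul_mpolyC scalerA.
have no_line : noetherian scalars line.
  move=> L smL Lline; have [[c c0 Lc]|noL] := pselect (exists2 c, c != 0 & L (c *: g)).
    exists [:: c *: g] => [x|N [_ _ NZ] sN x /Lline[d ->]].
      by rewrite /= inE => /eqP->.
    rewrite -[d](mulfVK c0) -scalerA -mul_mpolyC; apply: NZ; first by exists (d / c).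
    by apply: sN; rewrite /= mem_head.
  exists [::] => // N [N0 _ _] _ x Lx; have [c xE] := Lline _ Lx.
  have [c0|c0] := eqVneq c 0; first by rewrite xE c0 scale0r.
  by case: noL; exists c; rewrite // -xE.
exists (sum_set line M); split; last 1 first.
- move=> x; rewrite /= inE => /predU1P[->|xs].
    by exists g; [exists 1; rewrite scale1r | rewrite subrr; case: smM].
  by exists 0; [exists 0; rewrite scale0r | rewrite subr0; apply: sM].
- case: sm_line smM => A0 AB AZ [M0 MB MZ].
  split=> [|x y [a Aa Mx] [b Ab My]|c x Dc [a Aa Mx]].
  + by exists 0; rewrite ?subrr.
  + by exists (a - b); [apply: AB | rewrite subrACA; apply: MB].
  + by exists (c * a); [apply: AZ | rewrite -mulrBr; apply: MZ].
- exact: noetherian_sum.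
Qed.

(** Start from a noetherian space containing the module generators [s] and adjoin the elements of
    [t] one by one: the resulting submodule over [multipliers t] contains [s], hence everything. *)
Lemma noetherian_setT (t : seq P) :
  fg (multipliers t) setT -> noetherian (multipliers t) setT.
Proof.
move=> [s _ sgen] L smL _; have [M0 [smM0 noM0 sM0]] := noetherian_span s.
suff [M [smM noM sM]] : exists M, [/\ submod (multipliers t) M,
    noetherian (multipliers t) M & [set` s] `<=` M].
  by apply: noM => // x _; apply: (sgen M smM sM).
elim: t {sgen L smL} => [|b t [M [smM noM sM]]].
  exists M0; suff -> : multipliers [::] = scalars by [].
  by apply/seteqP; split=> x; [case | left].
exists (adjoin M b).
have -> : multipliers (b :: t) = b |` multipliers t.
  apply/seteqP; split=> x.
    by case=> [|/predU1P[]]; [right; left | left | right; right].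
  by case=> [->|[]]; [right; apply: mem_head | left | right; apply/predU1P; right].
split; first exact: submod_adjoin.
  exact: noetherian_adjoin.
by move=> x /sM; exact: (sub_adjoin b smM).
Qed.

Lemma msizeM_leq (p q : P) a b :
  (msize p <= a)%N -> (msize q <= b.+1)%N -> (msize (p * q) <= a + b)%N.
Proof.
have [->|p0] := eqVneq p 0; first by rewrite mul0r msize0.
have [->|q0] := eqVneq q 0; first by rewrite mulr0 msize0.
move=> pa qb; rewrite msizeM // -ltnS -addnS; apply: leq_trans (leq_add pa qb).
by rewrite prednK // addn_gt0 lt0n msize_poly_eq0 p0.
Qed.

Lemma msize_dhomog (p : P) d : p \is d.-homog -> (msize p <= d.+1)%N.
Proof.
move=> /dhomogP hom; rewrite msizeE; apply/bigmax_leqP_seq => m mp _.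
by rewrite (hom m mp).
Qed.

Lemma pihomog_dhomogM (p h : P) d e : p \is e.-homog ->
  pihomog mdeg d (p * h) = if (e <= d)%N then p * pihomog mdeg (d - e) h else 0.
Proof.
move=> hom_p; rewrite (pihomog_partitionE (leqnn (mmeasure mdeg h))).
rewrite mulr_sumr !raddf_sum mulr_sumr /=.
have -> (b : bool) (x : P) : (if b then x else 0) = x *+ b by case: b.
rewrite -sumrMnl; apply: eq_bigr => i _ /=.
have := pihomogP mdeg i h; set g := pihomog _ _ _ => hom_g.
have hom_pg := dhomogM hom_p hom_g.
have [ed|de] := leqP e d; last first.
  by rewrite (pihomog_ne0 _ hom_pg) // gtn_eqF // ltn_addr.
have [eid|eid] := eqVneq (e + i)%N d.
  by rewrite !pihomog_dE // -eid ?addKn.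
rewrite (pihomog_ne0 _ hom_pg) // (pihomog_ne0 _ hom_g) ?mulr0 //.
by apply: contraNneq eid => ->; rewrite subnKC.
Qed.

(* A monomial of large degree is a combination of the leading forms p_r, hence,
   up to terms of lower degree, of the b_r. *)
Lemma fg_leading_forms (t : seq P) (k : nat) (b p : 'I_k -> P) (e : 'I_k -> nat) :
  (forall r, b r \in t) -> (forall r, (0 < e r)%N) ->
  (forall r, p r \is (e r).-homog) -> (forall r, (msize (b r - p r) <= e r)%N) ->
  (forall j, exists M, exists h : 'I_k -> P, 'X_j ^+ M = \sum_r p r * h r) ->
  fg (multipliers t) setT.
Proof.
move=> bt e0 hom_p low /choice[M /choice[h hM]].
pose d0 := (\sum_j M j).+1.
exists [seq 'X_[val m] | m <- enum {: 'X_{1..n < d0}}] => // N smN sN.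
have NC c f : N f -> N (c *: f).
  by move=> Nf; rewrite -mul_mpolyC; case: smN => _ _; apply=> //; left; exists c.
suff NX d f : (msize f <= d)%N -> N f by move=> f _; exact: NX (leqnn _).
elim: d f => [|d IHd] f.
  by rewrite leqn0 msize_poly_eq0 => /eqP->; case: smN.
move=> size_f; rewrite [f]mpolyE big_seq; apply: submod_sum (smN) _ => m mf.
apply: NC; have := leq_trans (msize_mdeg_lt mf) size_f.
rewrite ltnS leq_eqVlt => /predU1P[dm|md]; last by apply: IHd; rewrite msizeX.
have [mdeg_lt|mdeg_ge] := ltnP (mdeg m) d0.
  apply: sN; apply/mapP; exists (BMultinom mdeg_lt) => //.
  by rewrite mem_enum.
(* If every exponent were below its bound [M j], the degree would be below [d0]. *)
have [j Mj] : exists j, (M j <= m j)%N.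
  apply: contrapT => /forallNP lt_m; move: mdeg_ge; rewrite leqNgt => /negP; apply.
  rewrite /d0 ltnS mdegE; apply: leq_sum => j _.
  by have /negP := lt_m j; rewrite -ltnNge => /ltnW.
pose m' := (m - U_(j) *+ M j)%MM.
have mE : m = (U_(j) *+ M j + m')%MM.
  rewrite addmC submK //; apply/mnm_lepP => i.
  by rewrite mulmnE mnm1E; case: eqP => [<-|_]; rewrite ?mul1n ?mul0n.
(* Taking components of degree [d] in the relation for ['X_j ^+ M j] makes the cofactors homogeneous
   of degree [d - e r]. *)
have XE : 'X_[m] = \sum_r p r * (if (e r <= d)%N then
    pihomog mdeg (d - e r) (h j r * 'X_[m']) else 0).
  rewrite -(pihomog_dE (mf := mdeg) (d := d) (p := 'X_[m])); last by rewrite dhomogX; apply/eqP.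
  rewrite [in LHS]mE mpolyXD -mpolyXn hM mulr_suml raddf_sum /=.
  apply: eq_bigr => r _; rewrite -mulrA (pihomog_dhomogM _ _ (hom_p r)).
  by case: ifP; rewrite ?mulr0.
rewrite XE; apply: submod_sum (smN) _ => r _.
case: ifP => [ed|_]; last by rewrite mulr0; case: smN.
have := pihomogP mdeg (d - e r)%N (h j r * 'X_[m']); set g := pihomog _ _ _ => hom_g.
have size_g := msize_dhomog hom_g.
(* Both [g] and the error term [(b r - p r) * g] have degree less than [d]. *)
have -> : p r * g = b r * g - (b r - p r) * g by rewrite mulrBl subKr.
case: (smN) => _ NB NZ; apply: NB.
  apply: NZ; first by right; apply: bt.
  by apply: IHd; apply: leq_trans size_g _; rewrite ltn_subrL e0 (leq_trans (e0 r)).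
by apply: IHd; rewrite -(subnKC ed); apply: msizeM_leq (low r) size_g.
Qed.

(* By noetherianity A is already finitely generated as a module. *)
Lemma finitely_generated_subalgebra (t : seq P) (A : set P) :
  fg (multipliers t) setT -> scalars `<=` A -> [set` t] `<=` A ->
  (forall f g, A f -> A g -> A (f - g)) -> (forall f g, A f -> A g -> A (f * g)) ->
  finitely_generated A.
Proof.
move=> fgt CA tA AB AM.
have A0 : A 0 by rewrite -(subrr 0); apply: AB; apply: CA; exists 0; rewrite // raddf0.
have AD f g : A f -> A g -> A (f + g).
  by move=> Af Ag; rewrite -[g]opprK -[- g]sub0r; apply/AB/AB.
have smA : submod (multipliers t) A.
  by split=> // a x [/CA|/tA] Aa Ax; apply: AM.
have [s sA sgen] := noetherian_setT fgt smA (fun x _ => I).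
exists (size (t ++ s)), (in_tuple (t ++ s)); set u := in_tuple _.
have uA i : A (tnth u i).
  have : tnth u i \in t ++ s by apply: mem_tnth.
  by rewrite mem_cat => /orP[/tA|/sA].
have gen_u x : x \in t ++ s -> range (fun Q => Q \mPo u) x.
  move=> /(tnthP u)[i ->]; exists 'X_i => //.
  by rewrite comp_mpolyXU (tnth_nth 0).
have genM x y : range (fun Q => Q \mPo u) x -> range (fun Q => Q \mPo u) y ->
    range (fun Q => Q \mPo u) (x * y).
  by move=> [Q _ <-] [Q' _ <-]; exists (Q * Q') => //; rewrite rmorphM.
apply/seteqP; split=> [|_ [Q _ <-]].
  (* The subalgebra generated by [u] is itself a submodule containing [s], so it contains [A]. *)
  apply: sgen; last by move=> x xs; apply: gen_u; rewrite mem_cat [x \in s]xs orbT.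
  split=> [|_ _ [Q _ <-] [Q' _ <-]|a x [[c _ <-]|xt]].
  - by exists 0; rewrite // raddf0.
  - by exists (Q - Q'); rewrite // raddfB.
  - by apply: genM; exists c%:MP; rewrite // comp_mpolyC.
  - by apply: genM; apply: gen_u; rewrite mem_cat [a \in t]xt.
rewrite comp_mpolyEX; apply: (big_ind A) => // m _.
rewrite -mul_mpolyC; apply: (AM); first by apply: CA; exists Q@_m.
rewrite comp_mpolyX; apply: (big_ind A) => [|f g|i _]; [by apply: CA; exists 1 | exact: (AM) | ].
elim: (m i) => [|d IHd]; first by rewrite expr0; apply: CA; exists 1.
by rewrite exprS; apply: AM.
Qed.

End MpolyFiniteness.

(** * Deformed Bernoulli sums *)

Section BernoulliSums.
Variables (K : numFieldType) (n m : nat) (kappa : K).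
Local Notation P := {mpoly K[n + m]}.
Local Notation V := 'rV[K]_(n + m).
Implicit Types (j : 'I_(n + m)) (z w : V).

(* A coordinate u_i is seen as an edge of length kappa centred at u_i, and v_p as
   an edge of length 1 centred at kappa v_p. *)
Definition edge_length j : K := if split j is inl _ then kappa else 1.
Definition edge_scale j : K := if split j is inl _ then 1 else kappa.
Definition center z j := edge_scale j * z 0 j.
Definition head z j := center z j + edge_length j / 2.
Definition tail z j := center z j - edge_length j / 2.

Lemma edge_length_lshift i : edge_length (lshift m i) = kappa.
Proof. by rewrite /edge_length (unsplitK (inl i)). Qed.

Lemma edge_length_rshift p : edge_length (rshift n p) = 1.
Proof. by rewrite /edge_length (unsplitK (inr p)). Qed.

Lemma center_lshift z i : center z (lshift m i) = ucoord z i.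
Proof. by rewrite /center /edge_scale (unsplitK (inl i)) mul1r. Qed.

Lemma center_rshift z p : center z (rshift n p) = kappa * vcoord z p.
Proof. by rewrite /center /edge_scale (unsplitK (inr p)). Qed.

Definition edgeE :=
  (edge_length_lshift, edge_length_rshift, center_lshift, center_rshift).

Definition center_poly j : P := edge_scale j *: 'X_j.

Definition bernoulli_sum r : P :=
  \sum_j ((center_poly j + (edge_length j / 2)%:MP) ^+ r
          - (center_poly j - (edge_length j / 2)%:MP) ^+ r).

Lemma eval_bernoulli_sum r z :
  eval_at (bernoulli_sum r) z = \sum_j (head z j ^+ r - tail z j ^+ r).
Proof.
rewrite /eval_at raddf_sum; apply: eq_bigr => j _ /=.
by rewrite mevalB !rmorphXn /= mevalB mevalD mevalC mevalZ mevalXU.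
Qed.

Lemma msize_leD (p q : P) d :
  (msize p <= d)%N -> (msize q <= d)%N -> (msize (p + q) <= d)%N.
Proof. by move=> pd qd; rewrite (leq_trans (msizeD_le _ _)) // geq_max pd. Qed.

Lemma msize_leZ (p : P) c d : (msize p <= d)%N -> (msize (c *: p) <= d)%N.
Proof. exact: leq_trans (msizeZ_le _ _). Qed.

Lemma msize_leM (p q : P) d :
  (msize p <= 2)%N -> (msize q <= d)%N -> (msize (p * q) <= d.+1)%N.
Proof. by move=> p2 qd; rewrite mulrC -addn1; apply: msizeM_leq. Qed.

Lemma msize_leX (x : P) r : (msize x <= 2)%N -> (msize (x ^+ r) <= r.+1)%N.
Proof.
move=> x2; elim: r => [|r IHr]; first by rewrite expr0 msize1.
by rewrite exprS; apply: msize_leM.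
Qed.

Lemma msize_addC_exp (x : P) (a : K) r :
  (msize x <= 2)%N -> (msize ((x + a%:MP) ^+ r - x ^+ r) <= r)%N.
Proof.
move=> x2; elim: r => [|r IHr]; first by rewrite !expr0 subrr msize0.
have -> : (x + a%:MP) ^+ r.+1 - x ^+ r.+1 =
    (x + a%:MP) * ((x + a%:MP) ^+ r - x ^+ r) + a *: x ^+ r.
  by rewrite -mul_mpolyC !exprS; ring.
apply: msize_leD; last exact/msize_leZ/msize_leX.
apply: msize_leM => //; apply: msize_leD => //.
by rewrite (leq_trans _ (_ : 1 <= 2)%N) // mmeasureC; case: eqP.
Qed.

Lemma msize_central_difference (x : P) (a : K) r : (msize x <= 2)%N ->
  (msize ((x + (a / 2)%:MP) ^+ r.+1 - (x - (a / 2)%:MP) ^+ r.+1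
          - r.+1%:R *: (a *: x ^+ r)) <= r)%N.
Proof.
move=> x2; have aE : a = a / 2 + a / 2 by rewrite -splitr.
move: (a / 2) aE => b ->; rewrite -mpolyCN.
elim: r => [|r IHr].
  by rewrite !expr1 expr0 -!mul_mpolyC mpolyCN mpolyCD !mpolyC_nat (_ : _ - _ = 0) ?msize0 //; ring.
(* Split one factor [x + b] or [x - b] off each power: the part in [x] is the induction hypothesis,
   the part in [b] compares both remaining powers with [x ^+ r.+1]. *)
rewrite (_ : _ - _ = x * ((x + b%:MP) ^+ r.+1 - (x + (- b)%:MP) ^+ r.+1
                      - r.+1%:R *: ((b + b) *: x ^+ r))
  + b *: ((x + b%:MP) ^+ r.+1 - x ^+ r.+1 +
          ((x + (- b)%:MP) ^+ r.+1 - x ^+ r.+1))); last first.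
  by rewrite -!mul_mpolyC mpolyCN mpolyCD !mpolyC_nat !exprS; ring.
by apply: msize_leD; [apply: msize_leM | apply/msize_leZ/msize_leD; apply: msize_addC_exp].
Qed.

Lemma msize_center_poly j : (msize (center_poly j) <= 2)%N.
Proof. by apply: msize_leZ; rewrite msizeX; apply/eq_leq/congr1/mdeg1. Qed.

Lemma dhomog_center_poly j : center_poly j \is 1.-homog.
Proof. by apply: dhomogZ; rewrite dhomogX; apply/eqP/mdeg1. Qed.

Hypotheses (kappa_neq0 : kappa <> 0) (kappa_special : ~ negative_special n m kappa).

Lemma edge_scale_neq0 j : edge_scale j != 0.
Proof. by rewrite /edge_scale; case: split => _; rewrite ?oner_neq0 //; apply/eqP. Qed.

(** With [q] edges of length kappa and [p] of length 1 the sum is [q kappa + p]. If it vanishes,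
    either [q = 0] and [S] is empty, or [p = 0] and kappa is zero, or kappa is [- p / q]. *)
Lemma sum_edge_length_neq0 (S : {set 'I_(n + m)}) :
  S != finset.set0 -> \sum_(j in S) edge_length j != 0.
Proof.
move=> S0; rewrite big_split_ord /=.
under eq_bigr do rewrite edge_length_lshift.
under [X in _ + X]eq_bigr do rewrite edge_length_rshift.
rewrite !sumr_const -[kappa *+ _]mulr_natr.
set q := #|_|; set p := #|_|.
have qn : (q <= n)%N by rewrite -[n in leqRHS]card_ord max_card.
have pm : (p <= m)%N by rewrite -[m in leqRHS]card_ord max_card.
have [q0|q0] := posnP q; last first.
  have [p0|p0] := posnP p.
    rewrite p0 addr0 mulf_neq0 ?pnatr_eq0 -?lt0n //; exact/eqP.
  apply/eqP => qp0; apply: kappa_special; exists p, q; split; rewrite ?p0 ?q0 //.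
  have qK : q%:R != 0 :> K by rewrite pnatr_eq0 -lt0n.
  by apply/(mulIf qK); rewrite mulNr mulfVK //; apply/eqP; rewrite -addr_eq0 qp0.
rewrite q0 mulr0 add0r pnatr_eq0; apply: contraNneq S0 => p0.
apply/eqP/setP => j; rewrite finset.in_set0; apply/negbTE/negP => jS.
case: (splitP j) => [i ji|i ji].
  have := card0_eq q0 i; rewrite /in_mem /= => /negbT/negP; apply.
  by have -> : lshift m i = j by apply: val_inj.
have := card0_eq p0 i; rewrite /in_mem /= => /negbT/negP; apply.
by have -> : rshift n i = j by apply: val_inj.
Qed.

(** Indices start at 2 since the sums of index 0 and 1 are constant. The leading forms are then the
    weighted power sums of exponents 1 to [n + m], one per variable as [nilpotent_mod_power_sums]
    requires. *)
Definition bernoulli_sums : seq P := [seq bernoulli_sum r.+2 | r : 'I_(n + m)].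

Lemma fg_bernoulli_sums : fg (multipliers bernoulli_sums) setT.
Proof.
pose power_sum r : P := \sum_j edge_length j *: center_poly j ^+ r.
pose lead (r : 'I_(n + m)) : P := r.+2%:R *: power_sum r.+1.
apply: (@fg_leading_forms _ _ _ (n + m) (fun r => bernoulli_sum r.+2) lead (fun r => r.+1)) => //.
- by move=> r; apply/codomP; exists r.
- move=> r; apply/dhomogZ/rpred_sum => j _; apply: dhomogZ.
  by have := dhomogMn r.+1 (dhomog_center_poly j); rewrite mul1n.
- move=> r; rewrite /lead scaler_sumr -sumrB.
  apply: (big_ind (fun f => msize f <= r.+1)%N); rewrite ?msize0 //.
    by move=> f g; apply: msize_leD.
  by move=> j _; apply/msize_central_difference/msize_center_poly.
move=> j; pose I : set P := [set f | exists h, f = \sum_r lead r * h r].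
have idI : ideal I.
  split=> [|_ _ [h ->] [g ->]|a _ _ [h ->]].
  - by exists (fun=> 0); rewrite big1 // => r _; rewrite mulr0.
  - by exists (fun r => h r - g r); rewrite -sumrB; apply: eq_bigr => r _; rewrite mulrBr.
  - by exists (fun r => a * h r); rewrite mulr_sumr; apply: eq_bigr => r _; rewrite mulrCA.
have [|||M [h hM]] := @nilpotent_mod_power_sums _ _ center_poly (n + m)
  finset.setT (fun i => (edge_length i)%:MP) I idI _ _ _ j (finset.in_setT j).
- by rewrite cardsT card_ord.
- move=> S _ S0; exists ((\sum_(i in S) edge_length i)^-1)%:MP.
  by rewrite -rmorph_sum -mpolyCM mulVf ?sum_edge_length_neq0.
- move=> [//|r] /andP[_ rN].
  exists (fun r' => if r' == Ordinal rN then (r.+2%:R^-1)%:MP else 0).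
  rewrite [RHS](bigD1 (Ordinal rN)) //= eqxx [X in _ = _ + X]big1 ?addr0; last first.
    by move=> r' /negPf->; rewrite mulr0.
  rewrite /lead mulrC mul_mpolyC scalerA mulVf ?pnatr_eq0 // scale1r.
  by apply: eq_big => [i|i _]; rewrite ?finset.in_setT ?mul_mpolyC.
(* The power obtained is that of [center_poly j]; dividing by [edge_scale j ^+ M] turns it into a
   power of the variable. *)
exists M, (fun r => (edge_scale j ^- M)%:MP * h r).
under eq_bigr do rewrite mulrCA.
rewrite -mulr_sumr -hM /center_poly exprZn mul_mpolyC scalerA mulVf ?scale1r //.
by rewrite expf_neq0 ?edge_scale_neq0.
Qed.

End BernoulliSums.

(** * Configurations of edges *)

Section Multisets.
Variable K : numFieldType.

(** Equal power sums give equal sums of any polynomial; one that vanishes at every entry other than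
    [x] isolates the multiplicity of [x], which characteristic zero lets one read off. *)
Lemma power_sums_perm_eq (s t : seq K) :
  (forall r, \sum_(x <- s) x ^+ r = \sum_(x <- t) x ^+ r) -> perm_eq s t.
Proof.
move=> eq_st; have eq_horner (h : {poly K}) : \sum_(x <- s) h.[x] = \sum_(x <- t) h.[x].
  under eq_bigr do rewrite horner_coef; under [RHS]eq_bigr do rewrite horner_coef.
  rewrite exchange_big [RHS]exchange_big; apply: eq_bigr => r _ /=.
  by rewrite -!mulr_sumr eq_st.
apply/allP => x _ /=; pose others := [seq y <- s ++ t | y != x].
pose h : {poly K} := \prod_(y <- others) ('X - y%:P).
have hx : h.[x] != 0 by rewrite -/(root h x) root_prod_XsubC mem_filter eqxx.
have count_h u : {subset u <= s ++ t} ->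
    \sum_(y <- u) h.[y] = h.[x] *+ count_mem x u.
  move=> ust; rewrite -sum1_count -sumrMnr [RHS]big_mkcond.
  rewrite [LHS]big_seq [RHS]big_seq; apply: eq_bigr => y /ust yst /=.
  have [->|yx] := eqVneq y x; first by rewrite mulr1n.
  by apply/eqP; rewrite -/(root h y) root_prod_XsubC mem_filter yx.
have := eq_horner h; rewrite !count_h => [/(mulrIn hx)->//||].
  by move=> y yt; rewrite mem_cat yt orbT.
by move=> y ys; rewrite mem_cat ys.
Qed.

(** No entry of [a] can be matched in [d], so multiplicities in [a] are at most those in [c], and
    equal sizes force equality. *)
Lemma perm_eq_cat_disjoint (T : eqType) (a b c d : seq T) :
  perm_eq (a ++ b) (c ++ d) -> {in a, forall x, x \notin d} ->
  size a = size c -> perm_eq a c.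
Proof.
move=> /seq.permP abcd ad size_ac.
have /count_subseqP[a' a'c aa'] x : (count_mem x a <= count_mem x c)%N.
  have [xa|xa] := boolP (x \in a); last by rewrite (count_memPn xa).
  have := abcd (pred1 x); rewrite !count_cat (count_memPn (ad x xa)) addn0 => <-.
  exact: leq_addr.
suff <- : a' = c by [].
by apply/eqP; rewrite -(size_subseq_leqif a'c) -(perm_size aa') size_ac.
Qed.

Variables (n m : nat) (kappa : K).
Implicit Types U W : seq K.

(** The Bernoulli sum in terms of sequences of centres, [U] for the kappa-edges and [W] for the
    1-edges, so that edges can be removed. *)
Definition flux r U W : K :=
  \sum_(u <- U) ((u + kappa / 2) ^+ r - (u - kappa / 2) ^+ r)
  + \sum_(w <- W) ((w + 1 / 2) ^+ r - (w - 1 / 2) ^+ r).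

(* No kappa-edge is followed by a 1-edge. *)
Definition terminal U W := {in U & W, forall u w, u + kappa / 2 != w - 1 / 2}.

Hypotheses (kappa_neq0 : kappa <> 0) (kappa_special : ~ positive_special n m kappa).

(* Reverse the edges of (U', W').  An edge of U, or a reversed edge of W', never
   ends where an edge of W, or a reversed edge of U', starts.  So in the balanced
   graph made of all these edges, those of U and the reversed ones of W' form a
   balanced subgraph, whose total displacement kappa |U| - |W'| is then zero. *)
Lemma disjoint_terminal U W U' W' : (size U <= n)%N -> (size W' <= m)%N ->
  terminal U W -> terminal U' W' ->
  {in U, forall u, u \notin U'} -> {in W', forall w, w \notin W} ->
  (forall r, flux r U W = flux r U' W') -> U = [::] /\ W' = [::].
Proof.
move=> Un W'm termUW termU'W' UU' WW' eq_flux.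
(* [t1] and [s1] hold the ends and the starts of the edges of [U] and of the reversed [W']; [t2] and
   [s2] those of [W] and of the reversed [U']. *)
pose t1 := [seq u + kappa / 2 | u <- U] ++ [seq w - 1 / 2 | w <- W'].
pose s1 := [seq u - kappa / 2 | u <- U] ++ [seq w + 1 / 2 | w <- W'].
pose t2 := [seq w + 1 / 2 | w <- W] ++ [seq u - kappa / 2 | u <- U'].
pose s2 := [seq w - 1 / 2 | w <- W] ++ [seq u + kappa / 2 | u <- U'].
have balanced : perm_eq (t1 ++ t2) (s1 ++ s2).
  apply: power_sums_perm_eq => r; apply/eqP; rewrite -subr_eq0.
  rewrite !big_cat !big_map /=; move: (eq_flux r) => /eqP.
  by rewrite -subr_eq0 /flux !sumrB; congr (_ == _); ring.
have /perm_eq_cat_disjoint/(_ _) : {in t1, forall x, x \notin s2}.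
  move=> x; rewrite !mem_cat => xt1; apply/negP.
  case/orP: xt1 => /mapP[a aU ->] /orP[]/mapP[b bW] => [/eqP|/addIr ab|/addIr ab|/eqP].
  - exact/negP/termUW.
  - by have := UU' a aU; rewrite ab bW.
  - by have := WW' a aU; rewrite ab bW.
  - by rewrite eq_sym; apply/negP/termU'W'.
move=> /(_ _ _ balanced); rewrite !size_cat !size_map => /(_ erefl) perm_ts.
have : \sum_(x <- t1) x = \sum_(x <- s1) x by apply: perm_big.
rewrite !big_cat !big_map /= !big_split /= !big_const_seq !count_predT !iter_addr_0.
move=> /eqP; rewrite -subr_eq0 => /eqP eq0.
have {}eq0 : kappa * (size U)%:R = (size W')%:R.
  apply/eqP; rewrite -subr_eq0 -[X in _ == X]eq0; apply/eqP.
  by field.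
have [U0|U0] := posnP (size U).
  move: eq0; rewrite U0 mulr0 => /esym/eqP; rewrite pnatr_eq0 => /eqP W0.
  by split; apply: size0nil.
have UK : (size U)%:R != 0 :> K by rewrite pnatr_eq0 -lt0n.
have [W0|W0] := posnP (size W').
  by move: eq0 => /eqP; rewrite W0 mulf_eq0 (negPf UK) orbF => /eqP.
case: kappa_special; exists (size W'), (size U).
by rewrite U0 W0; split=> //; rewrite -eq0 mulfK.
Qed.

(** Common edges are cancelled by induction on the number of edges. Once none is left,
    [disjoint_terminal] empties [U] and [W'], and equality of sizes empties the other two. *)
Lemma terminal_unique U W U' W' : (size U <= n)%N -> (size W <= m)%N ->
  size U = size U' -> size W = size W' -> terminal U W -> terminal U' W' ->
  (forall r, flux r U W = flux r U' W') -> perm_eq U U' /\ perm_eq W W'.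
Proof.
have perm_flux r U1 U2 W1 W2 : perm_eq U1 U2 -> perm_eq W1 W2 ->
    flux r U1 W1 = flux r U2 W2.
  by move=> pU pW; rewrite /flux (perm_big _ pU) (perm_big _ pW).
move: {2}(size U + size W)%N (leqnn (size U + size W)) => k.
elim: k U W U' W' => [|k IHk] U W U' W'.
  rewrite leqn0 addn_eq0 !size_eq0 => /andP[/eqP-> /eqP->] _ _ /esym/size0nil->.
  by move=> /esym/size0nil->.
move=> size_k Un Wm sU sW termUW termU'W' eq_flux.
have [[u uU uU']|disjU] := pselect (exists2 u, u \in U & u \in U').
  have pU := perm_to_rem uU; have pU' := perm_to_rem uU'.
  have [||||||||pUU' pWW'] := IHk (rem u U) W (rem u U') W' => //.
  - by rewrite -ltnS -addSn (leq_trans _ size_k) // -[X in (X + _)%N](perm_size pU).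
  - by rewrite (leq_trans (size_subseq (rem_subseq _ _))).
  - by rewrite !size_rem // sU.
  - by move=> x w /mem_rem xU; apply: termUW.
  - by move=> x w /mem_rem xU; apply: termU'W'.
  - move=> r; move: (eq_flux r); rewrite (perm_flux r _ _ _ _ pU (perm_refl W)).
    rewrite (perm_flux r _ _ _ _ pU' (perm_refl W')) /flux !big_cons -!addrA.
    by move/addrI/addrI.
  split=> //; rewrite (permPl pU) perm_sym (permPl pU') perm_sym.
  by rewrite perm_cons.
have [[w wW wW']|disjW] := pselect (exists2 w, w \in W & w \in W').
  have pW := perm_to_rem wW; have pW' := perm_to_rem wW'.
  have [||||||||pUU' pWW'] := IHk U (rem w W) U' (rem w W') => //.
  - by rewrite -ltnS -addnS (leq_trans _ size_k) // -[X in (_ + X)%N](perm_size pW).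
  - by rewrite (leq_trans (size_subseq (rem_subseq _ _))).
  - by rewrite !size_rem // sW.
  - by move=> u x uU /mem_rem; apply: termUW.
  - by move=> u x uU /mem_rem; apply: termU'W'.
  - move=> r; move: (eq_flux r); rewrite (perm_flux r _ _ _ _ (perm_refl U) pW).
    rewrite (perm_flux r _ _ _ _ (perm_refl U') pW') /flux !big_cons.
    by rewrite [LHS]addrCA [RHS]addrCA => /addrI.
  split=> //; rewrite (permPl pW) perm_sym (permPl pW') perm_sym.
  by rewrite perm_cons.
have [|||U0 W'0] := disjoint_terminal Un _ termUW termU'W' _ _ eq_flux.
- by rewrite -sW.
- by move=> u uU; apply/negP => uU'; apply: disjU; exists u.
- by move=> w wW'; apply/negP => wW; apply: disjW; exists w.
move: sU sW; rewrite U0 W'0 => /esym/size0nil-> /size0nil->.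
by split.
Qed.

End Multisets.

(** * Finiteness of level sets *)

Lemma finite_roots (K : fieldType) (p : {poly K}) :
  p != 0 -> exists s : seq K, forall x, root p x -> x \in s.
Proof.
move: {2}(size p) (leqnn (size p)) => k; elim: k p => [|k IHk] p size_p p0.
  by move: size_p; rewrite leqn0 size_poly_eq0 (negPf p0).
have [[a pa]|no_root] := pselect (exists a, root p a); last first.
  by exists [::] => x px; case: no_root; exists x.
have /factor_theorem[q pE] := pa.
have q0 : q != 0 by apply: contraNneq p0 => q0; rewrite pE q0 mul0r.
have [|//|s sP] := IHk q.
  by move: size_p; rewrite pE size_Mmonic ?monicXsubC // size_XsubC addn2.
exists (a :: s) => x; rewrite pE rootM root_XsubC inE => /orP[/sP->|->//].
by rewrite orbT.
Qed.

(* Finitely many functions span the restrictions to O of all polynomials, so the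
   powers of each coordinate are linearly dependent on O. *)
Lemma finite_level_set (K : fieldType) (N : nat) (t : seq {mpoly K[N]})
    (O : set 'rV[K]_N) : fg (multipliers t) setT ->
  (forall f, f \in t ->
     exists c, forall z, O z -> f.@[fun k => z 0 k] = c) -> finite_set O.
Proof.
move=> [s _ sgen] tO; pose D := size s.
pose ev (f : {mpoly K[N]}) (z : 'rV[K]_N) := f.@[fun k => z 0 k].
pose S : set {mpoly K[N]} :=
  [set f | exists c : 'I_D -> K, forall z, O z -> ev f z = \sum_l c l * ev s`_l z].
have SP f : S f.
  apply: (sgen S) => //; last first.
    move=> g /(nthP 0)[l lD <-]; exists (fun l' => (l' == Ordinal lD)%:R) => z _.
    rewrite (bigD1 (Ordinal lD)) //= eqxx mul1r big1 ?addr0 // => l' /negPf->.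
    by rewrite mul0r.
  split=> [|f1 f2 [c1 E1] [c2 E2]|a g].
  - by exists (fun=> 0) => z _; rewrite big1 /ev ?raddf0 // => l _; rewrite mul0r.
  - exists (fun l => c1 l - c2 l) => z Oz; rewrite /ev mevalB -!/(ev _ _) E1 // E2 //.
    by rewrite -sumrB; apply: eq_bigr => l _; rewrite mulrBl.
  - move=> Da [c E].
    have [b bE] : exists b, forall z, O z -> ev a z = b.
      by case: Da => [[b _ <-]|/tO//]; exists b => z _; rewrite /ev mevalC.
    exists (fun l => b * c l) => z Oz; rewrite /ev mevalM -!/(ev _ _) bE // E //.
    by rewrite mulr_sumr; apply: eq_bigr => l _; rewrite mulrA.
have roots j : exists r : seq K, forall z, O z -> z 0 j \in r.
  have [c cE] := choice (fun k => SP ('X_j ^+ k)).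
  (* [C] expresses [D + 1] powers of a coordinate through [D] functions on [O]; a vector in its left
     kernel gives a polynomial annihilating that coordinate. *)
  pose C := \matrix_(k < D.+1, l < D) c k l.
  have : kermx C != 0.
    rewrite kermx_eq0 /row_free; apply: contraL (rank_leq_col C) => /eqP->.
    by rewrite -ltnNge.
  case/rowV0Pn => v /sub_kermxP vC v0; pose q := \poly_(k < D.+1) v 0 (inord k).
  have q0 : q != 0.
    apply: contraNneq v0 => q0; apply/eqP/rowP => k; rewrite mxE.
    have := congr1 (fun q : {poly K} => q`_k) q0.
    by rewrite coef_poly coef0 ltn_ord inord_val.
  have [r rP] := finite_roots q0; exists r => z Oz; apply: rP.
  rewrite /root horner_poly; apply/eqP.
  transitivity (\sum_(k < D.+1) \sum_l (v 0 k * C k l) * ev s`_l z).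
    apply: eq_bigr => k _; rewrite inord_val.
    have -> : z 0 j ^+ k = ev ('X_j ^+ k) z by rewrite /ev rmorphXn /= mevalXU.
    rewrite cE // mulr_sumr; apply: eq_bigr => l _; rewrite mxE mulrA //.
  rewrite exchange_big big1 // => l _; rewrite -mulr_suml.
  have -> : \sum_(k < D.+1) v 0 k * C k l = (v *m C) 0 l by rewrite mxE.
  by rewrite vC mxE mul0r.
have [r rP] := choice roots.
(* A point of [O] is determined by the positions of its coordinates in the lists of roots. *)
pose pt (f : {ffun 'I_N -> 'I_(\max_j size (r j)).+1}) : 'rV[K]_N := \row_j (r j)`_(f j).
apply: (@sub_finite_set _ _ (range pt)); last first.
  exact/finite_image/finite_finset.
move=> z Oz; exists [ffun j => inord (index (z 0 j) (r j))] => //.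
apply/rowP => j; rewrite mxE ffunE inordK ?nth_index ?rP // ltnS.
by apply: leq_trans (leq_bigmax j); rewrite index_size.
Qed.

(** * Orbits *)

Lemma perm_eq_enum (T : eqType) k (f g : 'I_k -> T) :
  perm_eq [seq f i | i <- enum 'I_k] [seq g i | i <- enum 'I_k] ->
  exists s : 'S_k, f =1 g \o s.
Proof.
move=> /(tuple_permP (t := [tuple g i | i < k]))[s sE]; exists s => i.
have := congr1 (fun r => nth (f i) r i) sE.
by rewrite (nth_map i) ?size_enum_ord // nth_ord_enum -tnth_nth !tnth_mktuple.
Qed.

Section Orbits.
Variables (K : numFieldType) (n m : nat) (kappa : K).
Hypothesis kappa_neq0 : kappa <> 0.
Local Notation V := 'rV[K]_(n + m).
Local Notation step := (@groupoid_step K n m kappa).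
Local Notation orbit := (@groupoid_orbit K n m kappa).
Implicit Types (z w : V).

Lemma ucoord_perm_act s t z i : ucoord (perm_act s t z) i = ucoord z (s i).
Proof. by rewrite /ucoord /perm_act row_mxEl !mxE. Qed.

Lemma vcoord_perm_act s t z p : vcoord (perm_act s t z) p = vcoord z (t p).
Proof. by rewrite /vcoord /perm_act row_mxEr !mxE. Qed.

Lemma ucoord_shift z i p i' : ucoord (z + shift_vec K i p) i' = ucoord z i' + (i' == i)%:R.
Proof. by rewrite /ucoord !mxE eqxx eq_lshift eq_lrshift subr0. Qed.

Lemma vcoord_shift z i p p' : vcoord (z + shift_vec K i p) p' = vcoord z p' - (p' == p)%:R.
Proof. by rewrite /vcoord !mxE eqxx eq_rlshift eq_rshift sub0r. Qed.

Lemma coordP z w : ucoord z =1 ucoord w -> vcoord z =1 vcoord w -> z = w.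
Proof.
move=> eq_u eq_v; apply/rowP => j; case: (splitP j) => [i|p] jE.
  by rewrite (_ : j = lshift m i); [apply: eq_u | apply: val_inj].
by rewrite (_ : j = rshift n p); [apply: eq_v | apply: val_inj].
Qed.

Lemma groupoid_step_sym z w : step z w -> step w z.
Proof.
case=> [s t {}z|i p {}z zE|i p {}z zE].
- suff {2}<- : perm_act s^-1%g t^-1%g (perm_act s t z) = z by apply: StepPerm.
  by apply: coordP => ?; rewrite ?ucoord_perm_act ?vcoord_perm_act permKV.
- rewrite -{2}[z](addrK (shift_vec K i p)); apply: StepUnshift.
  rewrite ucoord_shift vcoord_shift !eqxx /=.
  by move/eqP: zE; rewrite subr_eq => /eqP->; field.
- rewrite -{2}[z](subrK (shift_vec K i p)); apply: StepShift.
  have zK := subrK (shift_vec K i p) z.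
  have uE := ucoord_shift (z - shift_vec K i p) i p i.
  have vE := vcoord_shift (z - shift_vec K i p) i p p.
  rewrite zK !eqxx in uE vE; move/eqP: zE; rewrite uE vE subr_eq -subr_eq0 => /eqP /= zE.
  by apply/eqP; rewrite -subr_eq0 -[X in _ == X]zE; apply/eqP; field.
Qed.

Lemma orbit_refl z : orbit z z.
Proof. exact: rt_refl. Qed.

Lemma orbit_trans z w x : orbit z w -> orbit w x -> orbit z x.
Proof. exact: rt_trans. Qed.

Lemma orbit_sym z w : orbit z w -> orbit w z.
Proof.
elim=> {z w} [z w zw|z|z w x _ wz _ xw]; first exact/rt_step/groupoid_step_sym.
  exact: rt_refl.
exact: rt_trans xw wz.
Qed.

Lemma orbit_eq z w : orbit z w -> orbit z = orbit w.
Proof.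
move=> zw; apply/seteqP; split=> x; last exact: orbit_trans.
exact/orbit_trans/orbit_sym.
Qed.

Lemma eval_bernoulli_sum_coord r z :
  eval_at (bernoulli_sum n m kappa r) z =
  \sum_i ((ucoord z i + kappa / 2) ^+ r - (ucoord z i - kappa / 2) ^+ r)
  + \sum_p ((kappa * vcoord z p + 1 / 2) ^+ r - (kappa * vcoord z p - 1 / 2) ^+ r).
Proof.
rewrite eval_bernoulli_sum big_split_ord /=.
by congr (_ + _); apply: eq_bigr => i _; rewrite /head /tail !edgeE.
Qed.

(** On the hyperplane of a shift the kappa-edge ends where the 1-edge starts. The shift exchanges
    the two steps of this path and so keeps its boundary. *)
Lemma bernoulli_sum_invariant r : invariants n m kappa (bernoulli_sum n m kappa r).
Proof.
have shift_inv z i p : ucoord z i - kappa * vcoord z p = - ((1 + kappa) / 2) ->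
    eval_at (bernoulli_sum n m kappa r) (z + shift_vec K i p) =
    eval_at (bernoulli_sum n m kappa r) z.
  move=> /eqP; rewrite subr_eq => /eqP zE; rewrite !eval_bernoulli_sum_coord.
  rewrite (bigD1 i) //= [X in _ + X](bigD1 p) //= [in RHS](bigD1 i) //=.
  rewrite [X in _ = _ + X](bigD1 p) //= ucoord_shift vcoord_shift !eqxx zE /=.
  under eq_bigr => i' /negPf i'i do rewrite ucoord_shift i'i addr0.
  under [X in _ + (_ + X) = _]eq_bigr => p' /negPf p'p do
    rewrite vcoord_shift p'p subr0.
  move: (\sum_(_ | _) _) (\sum_(_ | _) _) => A B.
  move: (vcoord z p) => v.
  (* These four identities match the ends of the kappa-edge, new then old, with those of the 1-edge,
     so that the powers cancel in pairs. *)
  have -> : - ((1 + kappa) / 2) + kappa * v + 1 + kappa / 2 = kappa * v + 1 / 2 by field.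
  have -> : - ((1 + kappa) / 2) + kappa * v + 1 - kappa / 2
     = kappa * (v - 1) + 1 / 2 by field.
  have -> : - ((1 + kappa) / 2) + kappa * v + kappa / 2 = kappa * v - 1 / 2 by field.
  have -> : - ((1 + kappa) / 2) + kappa * v - kappa / 2
     = kappa * (v - 1) - 1 / 2 by field.
  by ring.
move=> z w [s t {}z|i p {}z zE|i p {}z zE].
- rewrite !eval_bernoulli_sum_coord; congr (_ + _).
    rewrite [RHS](reindex_inj (@perm_inj _ s)) /=.
    by apply: eq_bigr => i _; rewrite ucoord_perm_act.
  rewrite [RHS](reindex_inj (@perm_inj _ t)) /=.
  by apply: eq_bigr => p _; rewrite vcoord_perm_act.
- exact: shift_inv.
- rewrite -[in RHS](subrK (shift_vec K i p) z) shift_inv //.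
  have uE := ucoord_shift (z - shift_vec K i p) i p i.
  have vE := vcoord_shift (z - shift_vec K i p) i p p.
  rewrite subrK !eqxx in uE vE; move/eqP: zE; rewrite uE vE subr_eq -subr_eq0 => /eqP /= zE.
  by apply/eqP; rewrite -subr_eq0 -[X in _ == X]zE; apply/eqP; field.
Qed.

Lemma invariant_orbit f z w : invariants n m kappa f -> orbit z w ->
  eval_at f w = eval_at f z.
Proof. by move=> fI; elim=> {z w} [z w /fI|//|z w x _ <- _ ->]. Qed.

Definition usum z : K := \sum_i ucoord z i.

Lemma usum_shift z i p : usum (z + shift_vec K i p) = usum z + 1.
Proof.
rewrite /usum; under eq_bigr do rewrite ucoord_shift.
rewrite big_split /= [X in _ + X](bigD1 i) //= eqxx [X in _ + (_ + X)]big1 ?addr0 //.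
by move=> i' /negPf->.
Qed.

(** In characteristic zero [usum] takes infinitely many values on such an orbit. This serves both
    for the staircases and to show that shifting terminates. *)
Lemma infinite_orbit z :
  (forall k, exists2 w, orbit z w & usum w = usum z + k%:R) ->
  ~ finite_set (orbit z).
Proof.
move=> orb /(finite_image usum)/finite_seqP[s sE].
pose t := mkseq (fun k => usum z + k%:R) (size s).+1.
have /uniq_leq_size : uniq t.
  by rewrite mkseq_uniq // => k l /addrI/eqP; rewrite eqr_nat => /eqP.
move=> /(_ s); rewrite size_mkseq ltnn => /(_ _)/negP; apply=> // x.
move=> /mapP[k _ ->]; have [w zw <-] := orb k.
by have : [set` s] (usum w) by rewrite -sE; exists w.
Qed.

Lemma finite_orbit z : ~ negative_special n m kappa -> finite_set (orbit z).
Proof.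
move=> special; apply: finite_level_set (fg_bernoulli_sums kappa_neq0 special) _.
move=> f /codomP[r ->]; exists (eval_at (bernoulli_sum n m kappa r.+2) z) => w.
exact/invariant_orbit/bernoulli_sum_invariant.
Qed.

(** * Infinite orbits for negative special kappa *)

(* [clock q t i]: the smallest integer >= t congruent to i mod q, for i < q. *)
Fixpoint clock (q t i : nat) : nat :=
  if t is t'.+1 then (clock q t' i + (i == t' %% q) * q)%N else i.

(** Each residue class has a single member in the window from [t] to [t + q - 1]; for the class of
    [t] it is [t]. *)
Lemma clock_modn q t : (0 < q)%N -> clock q t (t %% q)%N = t.
Proof.
move=> q0; have window c u : c = u %[mod q] -> (u <= c)%N -> (c < u + q)%N -> c = u.
  move=> mod_u le_u lt_u; have : (c - u < q)%N by rewrite ltn_subLR.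
  move/modn_small; have /eqP-> : (q %| c - u)%N by rewrite -eqn_mod_dvd //; apply/eqP.
  by move/esym/eqP; rewrite subn_eq0 => cu; apply/eqP; rewrite eqn_leq cu.
suff clockP i : (i < q)%N ->
    [/\ clock q t i = i %[mod q], (t <= clock q t i)%N & (clock q t i < t + q)%N].
  have [|mod_t le_t lt_t] := clockP (t %% q)%N; first exact: ltn_pmod.
  by apply: window; rewrite // mod_t modn_mod.
move=> iq; elim: t => [|t [mod_t le_t lt_t]] /=; first by split; rewrite ?add0n.
have [iE|it] := eqVneq i (t %% q)%N.
  rewrite mul1n modnDr; split=> //.
    by rewrite -addn1 leq_add.
  by rewrite (window (clock q t i) t) ?addSn // mod_t iE modn_mod.
rewrite mul0n addn0; split=> //; last by rewrite addSn ltnS ltnW.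
rewrite ltn_neqAle le_t andbT; apply: contraNneq it => tE.
by have := congr1 (modn^~ q) tE; rewrite /= mod_t (modn_small iq) => ->.
Qed.

(* For kappa = - p / q, edges of length kappa ending at the points a / q and edges
   of length 1 starting at the points b / q, for a in [t, t + q) and b in [t, t + p):
   flipping the two edges that meet at t / q gives the same configuration for t + 1. *)
Definition staircase (p q t : nat) : V :=
  row_mx (\row_i ((clock q t i)%:R / q%:R - kappa / 2))
         (\row_j (((clock p t j)%:R / q%:R + 1 / 2) / kappa)).

Lemma negative_special_infinite_orbit :
  negative_special n m kappa -> exists z, ~ finite_set (orbit z).
Proof.
move=> [p [q [/andP[p0 pm] /andP[q0 qn] kE]]].
have qK : q%:R != 0 :> K by rewrite pnatr_eq0 -lt0n.
have kK : kappa != 0 by apply/eqP.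
exists (staircase p q 0); apply: infinite_orbit => t; exists (staircase p q t).
  elim: t => [|t IHt]; first exact: orbit_refl.
  (* Index [t %% q] carries the kappa-edge that ends at [t / q], and index [t %% p] the 1-edge that
     starts there. *)
  have iP : (t %% q < n)%N by rewrite (leq_trans _ qn) // ltn_pmod.
  have jP : (t %% p < m)%N by rewrite (leq_trans _ pm) // ltn_pmod.
  apply: orbit_trans IHt _; apply: rt_step.
  (* Adding 1 to the first coordinate advances its clock by [q]; subtracting 1 from the second moves
     its centre by [- kappa = p / q], so advances its clock by [p]. *)
  have -> : staircase p q t.+1 =
      staircase p q t + shift_vec K (Ordinal iP) (Ordinal jP).
    apply: coordP => i; rewrite ?ucoord_shift ?vcoord_shift /ucoord /vcoord.
      rewrite !row_mxEl !mxE /= -val_eqE /= natrD natrM; case: eqP => _ /=; by field.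
    rewrite !row_mxEr !mxE /= -val_eqE /= natrD natrM; case: eqP => _ /=.
      by rewrite kE; field; rewrite qK pnatr_eq0 -lt0n.
    by field; rewrite qK kK.
  apply: StepShift; rewrite /ucoord /vcoord row_mxEl row_mxEr !mxE /= !clock_modn //.
  by field; rewrite qK kK.
elim: t => [|t IHt]; first by rewrite addr0.
have iP : (t %% q < n)%N by rewrite (leq_trans _ qn) // ltn_pmod.
rewrite -[t.+1]addn1 natrD addrA -IHt /usum (bigD1 (Ordinal iP)) //=.
rewrite [in RHS](bigD1 (Ordinal iP)) //= -[RHS]addrA [X in _ = _ + X]addrC addrA.
congr (_ + _).
  rewrite /ucoord !row_mxEl !mxE addn1 /= eqxx mul1n natrD; by field.
apply: eq_bigr => i; rewrite -val_eqE /= => /negPf it.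
by rewrite /ucoord !row_mxEl !mxE addn1 /= it mul0n addn0.
Qed.

(** * Finite generation and separation of orbits *)

Lemma invariants_finitely_generated :
  ~ negative_special n m kappa -> finitely_generated (invariants n m kappa).
Proof.
move=> special.
apply: (finitely_generated_subalgebra (fg_bernoulli_sums kappa_neq0 special)).
- by move=> _ [c _ <-] z w _; rewrite /eval_at !mevalC.
- by move=> _ /codomP[r ->]; apply: bernoulli_sum_invariant.
- by move=> f g fI gI z w zw; rewrite /eval_at !mevalB -!/(eval_at _ _) (fI _ _ zw) (gI _ _ zw).
- by move=> f g fI gI z w zw; rewrite /eval_at !mevalM -!/(eval_at _ _) (fI _ _ zw) (gI _ _ zw).
Qed.

Definition ucoords z := [seq ucoord z i | i <- enum 'I_n].
Definition vcenters z := [seq kappa * vcoord z p | p <- enum 'I_m].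

(* Each shift increases [usum], so that shifts cannot be applied indefinitely. *)
Lemma exists_terminal z : ~ negative_special n m kappa ->
  exists2 w, orbit z w & terminal kappa (ucoords w) (vcenters w).
Proof.
move=> special; apply: contrapT => no_terminal.
apply: (@infinite_orbit z) (finite_orbit z special).
(* As no point of the orbit is terminal, every point reached admits one more shift. *)
elim=> [|k [w zw wk]]; first by exists z; [apply: orbit_refl | rewrite addr0].
have [i [p ip]] : exists i p, ucoord w i - kappa * vcoord w p = - ((1 + kappa) / 2).
  apply: contrapT => no_shift; apply: no_terminal; exists w => //.
  move=> _ _ /mapP[i _ ->] /mapP[p _ ->]; apply/eqP => ip; apply: no_shift.
  exists i, p; apply/eqP; rewrite -subr_eq0; move/eqP: ip; rewrite -subr_eq0.
  by congr (_ == 0); field.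
exists (w + shift_vec K i p); first exact: orbit_trans zw (rt_step _ _ _ _ (StepShift ip)).
by rewrite usum_shift wk -addrA -natr1.
Qed.

(** The Bernoulli sums alone separate: if they agree at [z] and [w], they agree at terminal points
    of the two orbits, whose centres then coincide up to permutation. *)
Lemma separates_orbits_invariants :
  ~ negative_special n m kappa -> ~ positive_special n m kappa ->
  separates_orbits kappa (invariants n m kappa).
Proof.
move=> nspecial pspecial z w zw; apply: contrapT => no_sep; apply: zw.
have [z' zz' termz] := exists_terminal z nspecial.
have [w' ww' termw] := exists_terminal w nspecial.
have eq_bern r : eval_at (bernoulli_sum n m kappa r) z' =
    eval_at (bernoulli_sum n m kappa r) w'.
  have inv := bernoulli_sum_invariant r.
  rewrite (invariant_orbit inv zz') (invariant_orbit inv ww').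
  by apply: contrapT => neq; apply: no_sep; exists (bernoulli_sum n m kappa r).
have sizeU x : size (ucoords x) = n by rewrite size_map size_enum_ord.
have sizeW x : size (vcenters x) = m by rewrite size_map size_enum_ord.
have fluxE r x : flux kappa r (ucoords x) (vcenters x) =
    eval_at (bernoulli_sum n m kappa r) x.
  by rewrite eval_bernoulli_sum_coord /flux !big_map ?big_enum.
have [|||||||permU permV] := terminal_unique kappa_neq0 pspecial
  (U := ucoords z') (W := vcenters z') (U' := ucoords w') (W' := vcenters w').
all: rewrite ?sizeU ?sizeW //.
  by move=> r; rewrite !fluxE.
have [s sE] := perm_eq_enum permU.
have [t tE] := perm_eq_enum permV.
have z'E : z' = perm_act s t w'.
  apply: coordP => i; first by rewrite ucoord_perm_act sE.
  rewrite vcoord_perm_act; apply: (mulfI (x := kappa)); first exact/eqP.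
  exact: tE.
rewrite (orbit_eq zz') (orbit_eq ww'); apply/esym/orbit_eq.
by rewrite z'E; apply/rt_step/StepPerm.
Qed.

End Orbits.

Local Close Scope classical_set_scope.

Theorem theorem1p1 (R : realType) (n m : nat) (n_ge1 : (1 <= n)%N)
    (m_ge1 : (1 <= m)%N) (kappa : R[i]) (kappa_neq0 : kappa <> 0) :
  [/\ (forall z : 'rV[R[i]]_(n + m), finite_set (groupoid_orbit kappa z))
        <-> ~ negative_special n m kappa,
      ~ negative_special n m kappa ->
        finitely_generated (invariants n m kappa)
    & ~ negative_special n m kappa -> ~ positive_special n m kappa ->
        separates_orbits kappa (invariants n m kappa)].
Proof.
split; last exact: separates_orbits_invariants.
  split=> [fin special|special z]; last exact: finite_orbit.
  by have [z] := negative_special_infinite_orbit kappa_neq0 special; apply.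
exact: invariants_finitely_generated.
Qed.
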